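(* Let $z=x+iy\in\mathbb C$ with $\arg z\in(-\pi,\pi)$ and let $\lambda_1>0$ be given. Then there exist $c=c(z,\lambda_1)>0$ and $\Lambda_0=\Lambda_0(z,\lambda_1)$ such that the following holds for every positive definite Hermitian operator $A$ on a finite-dimensional complex inner product space $V$ whose smallest eigenvalue is $\lambda_1$ and whose largest eigenvalue $\lambda_N$ satisfies $\lambda_N\ge\Lambda_0$. Put $A_z:=zI+A$, $\mathsf a:=z+\lambda_1$, $\mathsf b:=z+\lambda_N$, $\mathsf c:=\tfrac12(\mathsf a+\mathsf b)$, $\mathsf d:=i(\mathsf b-\mathsf a)$, and let $\alpha_z:=1/(\mathsf c+s\mathsf d)$, where $s\in\mathbb R$ minimizes $R(s):=\bigl|1-\frac{\mathsf a}{\mathsf c+s\mathsf d}\bigr|^2$. Then the error reduction factor $\varepsilon_z$ of the Richardson iteration satisfies $$\varepsilon_z:=\min_{\alpha\in\mathbb C}\|I-\alpha A_z\|=|1-\alpha_z\mathsf a|\le 1-c\lambda_N^{-1}.$$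
   Context: $\|\cdot\|$ is the norm of the inner product on $V$ and the induced operator norm. The Richardson iteration for $A_zw=g$ with acceleration parameter $\alpha\in\mathbb C$ is $w^{n+1}=(I-\alpha A_z)w^n+\alpha g$, $n\ge0$, with $w^0$ given; its error satisfies $\|w^{n+1}-w\|\le\|I-\alpha A_z\|\,\|w^n-w\|$. When $y\ne0$ (so that $\mathsf a,\mathsf b$ are linearly independent over $\mathbb R$), the minimizing $s$ is $s_{\min}=-\mathsf f_1\pm\sqrt{\mathsf f_1^2-\mathsf f_2}$, the sign $\pm$ being that of $\operatorname{Re}(\mathsf a\overline{\mathsf d})$, where $\mathsf f_1=\frac{2\operatorname{Re}(\mathsf a\overline{\mathsf c})-|\mathsf a|^2}{2\operatorname{Re}(\mathsf a\overline{\mathsf d})}$ and $\mathsf f_2=\frac{2\mathsf f_1\operatorname{Re}(\mathsf c\overline{\mathsf d})-|\mathsf c|^2}{|\mathsf d|^2}$. The minimization of $R$ is over those $s\in\mathbb R$ with $\mathsf c+s\mathsf d\neq0$. *)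

(* Defs.v *)
From HB Require Import structures.
From mathcomp Require Import all_boot all_order all_algebra sesquilinear.
From mathcomp Require Import complex.
From mathcomp Require Import mathcomp_extra boolp classical_sets reals trigo.

Set Implicit Arguments.
Unset Strict Implicit.
Unset Printing Implicit Defensive.

Import Order.TTheory GRing.Theory Num.Theory.
Import ComplexField.Normc(normc).

Local Open Scope classical_set_scope.
Local Open Scope complex_scope.
Local Open Scope ring_scope.

Definition is_min {d : Order.disp_t} {T : porderType d} (S : set T) (m : T) : Prop :=
  S m /\ lbound S m.

Definition is_max {d : Order.disp_t} {T : porderType d} (S : set T) (m : T) : Prop :=
  S m /\ ubound S m.

Definition minimizes {R : realType} {T : Type} (D : set T) (f : T -> R) (t : T) : Prop :=
  D t /\ is_min (f @` D) (f t).

(* 0 has no argument. *)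
Definition is_arg {R : realType} (z : R[i]) (theta : R) : Prop :=
  z != 0 /\ z = (normc z)%:C * (cos theta +i* sin theta).

Section InnerProductSpace.
Context {R : realType} {V : vectType R[i]}.
(* The form is linear in its first argument and conjugate-linear in its second. *)
Variable dot : {dot V for (@Num.conj R[i])}.

Definition dot_norm (u : V) : R := Num.sqrt (complex.Re (dot u u)).

Definition op_norm (T : 'End(V)) : R :=
  sup [set dot_norm (T u) | u in [set u | dot_norm u <= 1]].

Definition hermitian_op (A : 'End(V)) : Prop :=
  forall u v, dot (A u) v = dot u (A v).

(* The order of R[i] makes 0 < w mean that w is real and positive. *)
Definition posdef_op (A : 'End(V)) : Prop :=
  forall u, u != 0 -> 0 < dot (A u) u.

(* A_z = z I + A *)
Definition shifted_op (z : R[i]) (A : 'End(V)) : 'End(V) := z *: \1%VF + A.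

(* Richardson's iteration for B w = g is w |-> (I - alpha B) w + alpha g,
   so I - alpha B is the operator that maps each error to the next one. *)
Definition richardson_error_op (B : 'End(V)) (alpha : R[i]) : 'End(V) :=
  \1%VF - alpha *: B.

Definition richardson_rates (B : 'End(V)) : set R :=
  [set op_norm (richardson_error_op B alpha) | alpha in [set: R[i]]].

(* As an infimum this is total; it is the error reduction factor when it is
   attained, that is, when [is_min (richardson_rates B)] holds of it. *)
Definition error_reduction_factor (B : 'End(V)) : R := inf (richardson_rates B).

End InnerProductSpace.

(* Main.v *)
Require Import Defs.
From mathcomp Require Import all_boot all_order all_algebra sesquilinear spectral.
From mathcomp Require Import complex.
From mathcomp Require Import mathcomp_extra boolp classical_sets reals trigo.
From mathcomp Require Import ring lra.
Import Order.TTheory GRing.Theory Num.Theory.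
Import ComplexField.Normc(normc).
Import ComplexField.Normc(normcM, normcV).
Import passmx(leigenvalue).
Local Open Scope classical_set_scope.
Local Open Scope complex_scope.
Local Open Scope ring_scope.

(** The operator [I - alpha A_z] is [p + q A] with [p = 1 - alpha z] and
    [q = - alpha]. As [A] is Hermitian, its eigenvectors for distinct
    eigenvalues are orthogonal and span [V], so the norm of [p + q A] is the
    largest [|p + q mu|] over the eigenvalues [mu]. These lie in the interval
    from [lambda1] to [lambdaN], and [|p + q mu|] is convex in [mu]; so

      [||I - alpha A_z|| = max (|1 - alpha a|, |1 - alpha b|)]

    with [a = z + lambda1] and [b = z + lambdaN] ([richardson_op_norm]).

    This leaves a problem in the plane. From
    [b - a = b (1 - alpha a) - a (1 - alpha b)] the maximum is at least
    [rho = |b - a| / (|a| + |b|)] for every [alpha]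
    ([two_point_lower_bound]). Geometrically, the discs of radii [r / |a|] and
    [r / |b|] about [1 / a] and [1 / b] meet only if [r >= rho]; for [r = rho]
    they touch at [(|a| / a + |b| / b) / (|a| + |b|)] ([two_point_opt]), where
    both moduli equal [rho]. Hence [rho] is the minimum over all [alpha].

    The points [c + s d] form the perpendicular bisector of the segment from
    [a] to [b], and [w] lies on it exactly when [|1 - a / w| = |1 - b / w|].
    So [R(s) >= rho ^ 2] for every admissible [s], while the inverse of the
    tangency point is on the bisector and attains equality; every minimizer
    [s] therefore has [|1 - alpha_z a| = rho].

    Finally
    [1 - rho = (|a| + |b| - (lambdaN - lambda1)) / (|a| + |b|)]. As
    [|b| >= Re b], the numerator is at least [|a| + Re a], which is positive
    because [a] is off the negative real axis; the denominator is at most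
    [2 lambdaN] once [lambdaN >= |a| + |z|]. So the
    bound holds with the constant [(|a| + Re a) / 2]. *)

(** * Spectral theory of Hermitian operators *)

Section Spectral.
Context {C : numClosedFieldType} {V : vectType C}.

Lemma leigenvalueP (A : 'End(V)) (mu : C) :
  leigenvalue A mu <-> exists2 e, e != 0 & A e = mu *: e.
Proof.
rewrite /leigenvalue /passmx.leigenspace -vpick0; split=> [e0|[e e0 Ae]].
  exists (vpick (lker (A - mu *: \1%VF))) => //.
  have := memv_pick (lker (A - mu *: \1%VF)).
  by rewrite memv_ker !lfun_simp subr_eq0 => /eqP.
rewrite vpick0; apply: contraNneq e0 => k0.
by rewrite -memv0 -k0 memv_ker !lfun_simp Ae subrr.
Qed.

Lemma stable_eigenvector (A : 'End(V)) (W : {vspace V}) :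
  W != 0%VS -> (A @: W <= W)%VS ->
  exists mu e, [/\ e \in W, e != 0 & A e = mu *: e].
Proof.
move=> W0 AW.
pose B : 'End(subvs_of W) := linfun (vsproj W \o A \o vsval).
pose b := vbasis {:subvs_of W}.
have b_basis : basis_of {:subvs_of W} b := vbasisP _.
have [|mu] := eigenvalue_closed (passmx.mxof b b B).
  by rewrite dimvf /= lt0n dimv_eq0.
move=> /eigenvalueP[u uB u0].
pose e := passmx.vecof b u; exists mu, (vsval e); split.
- exact: subvsP.
- apply: contraNneq u0 => e0; have : e = 0 by apply: subvs_inj; rewrite e0.
  by move/eqP; rewrite passmx.vecof_eq0.
have Be : B e = mu *: e.
  rewrite (passmx.hom_vecof b b_basis) uB /e /passmx.vecof scaler_sumr.
  by apply: eq_bigr => i _; rewrite mxE scalerA.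
have -> : mu *: vsval e = vsval (mu *: e) by [].
rewrite -Be lfunE /= vsprojK //.
by apply: (subvP AW); apply: memv_img; apply: subvsP.
Qed.

Variable dot : {dot V for (@Num.conj C)}.

(** The spectral theorem as an induction principle: every vector is built
    from [0] by adding eigenvectors orthogonal to what is already there. The
    vector [e] may be zero, but [mu] is always an eigenvalue. *)
Lemma hermitian_eigen_ind (A : 'End(V)) (P : V -> Prop) :
  (forall u v, dot (A u) v = dot u (A v)) ->
  P 0 ->
  (forall mu e w, leigenvalue A mu -> A e = mu *: e -> dot e w = 0 ->
     P w -> P (e + w)) ->
  forall u, P u.
Proof.
move=> hA P0 PD u.
(* Induct on the dimension of an [A]-stable subspace containing [u]. *)
suff [n] : exists n, (\dim {:V} <= n)%N.
  have /subvP/(_ u (memvf u)) := subvv (fullv : {vspace V}).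
  have : (A @: fullv <= (fullv : {vspace V}))%VS by exact: subvf.
  elim: n (fullv : {vspace V}) u => [|n IHn] W u AW uW.
    by rewrite leqn0 dimv_eq0 => /eqP W0; move: uW; rewrite W0 memv0 => /eqP->.
  move=> dW; have [W0|Wn0] := eqVneq W 0%VS.
    by move: uW; rewrite W0 memv0 => /eqP->.
  have [mu [e [eW e0 Ae]]] := stable_eigenvector A W Wn0 AW.
  (* The part of [W] orthogonal to [e] is stable because [A] is Hermitian. *)
  pose W' := (W :&: orthov dot <[e]>)%VS.
  have ee0 : dot e e != 0 by rewrite dnorm_eq0.
  have W'E w : (w \in W') = (w \in W) && (dot w e == 0).
    by rewrite memv_cap mem_orthov1.
  have dW' : (\dim W' <= n)%N.
    rewrite -(@eq_dim_orthov1 _ _ _ _ dot e W); first by case: (\dim W) dW.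
    by apply/mem_orthovPn; exists e.
  have AW' : (A @: W' <= W')%VS.
    apply/subvP => _ /memv_imgP[w + ->]; rewrite !W'E => /andP[wW /eqP we].
    by rewrite (subvP AW) ?memv_img //= hA Ae linearZr_LR /= we mulr0.
  pose c := dot u e / dot e e.
  have orth : dot (u - c *: e) e = 0.
    by rewrite linearBl linearZl_LR /= divfK // subrr.
  have := IHn W' (u - c *: e) AW'; rewrite W'E orth eqxx andbT.
  have -> : u - c *: e \in W by rewrite memvB ?memvZ.
  move=> /(_ isT dW') Pw.
  rewrite -(subrK (c *: e) u) addrC.
  apply: (PD mu) Pw.
  - by apply/leigenvalueP; exists e.
  - by rewrite linearZ /= Ae !scalerA mulrC.
  - rewrite linearZl_LR /=; apply/eqP; rewrite mulf_eq0 herm_eq0C; apply/orP; right.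
    exact/eqP.
by exists (\dim {:V}).
Qed.

(** For Hermitian [A], the operator [p + q A] expands no vector by more than
    the largest [|p + q mu|], [mu] an eigenvalue. *)
Lemma hermitian_affine_bound (A : 'End(V)) (p q M : C) :
  (forall u v, dot (A u) v = dot u (A v)) ->
  (forall mu, leigenvalue A mu -> `|p + q * mu| <= M) ->
  forall u, let Tu := p *: u + q *: A u in dot Tu Tu <= M ^+ 2 * dot u u.
Proof.
move=> hA hM; apply: (hermitian_eigen_ind A) => //.
  by rewrite /= (linear0 A) !scaler0 addr0 !linear0l mulr0.
move=> mu e w muA Ae ew /= IH.
have ewT : dot e (p *: w + q *: A w) = 0.
  by rewrite linearDr !linearZr_LR /= -hA Ae linearZl_LR /= ew !mulr0 addr0.
have -> : p *: (e + w) + q *: A (e + w)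
        = (p + q * mu) *: e + (p *: w + q *: A w).
  have -> : A (e + w) = mu *: e + A w by rewrite linearD /= Ae.
  by rewrite !scalerDr scalerDl scalerA addrACA.
have eT : dot ((p + q * mu) *: e) (p *: w + q *: A w) = 0.
  by rewrite linearZl_LR /= ewT mulr0.
have dotD x y : dot x y = 0 -> dot (x + y) (x + y) = dot x x + dot y y.
  exact: hnormDd.
rewrite (dotD _ _ eT) (dotD _ _ ew) dnormZ mulrDr lerD //.
rewrite ler_wpM2r ?dnorm_ge0 // lerXn2r ?hM ?nnegrE //.
exact: le_trans (normr_ge0 _) (hM _ muA).
Qed.

End Spectral.

(** * Plane geometry: the best factor for two points *)

Section Plane.
Context {R : realType}.
Implicit Types a b p q w : R[i].

Lemma normc_ge0 w : 0 <= normc w.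
Proof. by case: w => x y; exact: sqrtr_ge0. Qed.

Lemma normc_gt0 w : (0 < normc w) = (w != 0).
Proof. by rewrite -ltcR (_ : (normc w)%:C = `|w|) // normr_gt0. Qed.

Lemma normc_real (r : R) : normc r%:C = `|r|.
Proof. by rewrite /= expr0n addr0 sqrtr_sqr. Qed.

Lemma normc_sub w1 w2 : normc (w1 - w2) <= normc w1 + normc w2.
Proof. by rewrite -(normcN w2); exact: le_normcD. Qed.

(** A number with argument strictly between [- pi] and [pi] is off the closed
    negative real axis. *)
Lemma is_arg_Re_gt0 z (theta : R) :
  is_arg z theta -> - pi < theta < pi -> complex.Im z = 0 -> 0 < complex.Re z.
Proof.
move=> [z0 zE] /andP[lo hi] imz.
have nz : 0 < normc z by rewrite normc_gt0.
have st : sin theta = 0.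
  apply/eqP; move/eqP: imz; rewrite zE /= mul0r addr0 mulf_eq0.
  by rewrite (gt_eqF nz).
have t0 : theta = 0.
  case: (ltgtP theta 0) => // ht.
  - have := @sin_gt0_pi _ (- theta); rewrite oppr_gt0 ht ltrNl lo => /(_ isT).
    by rewrite sinN st oppr0 ltxx.
  - by have := @sin_gt0_pi _ theta; rewrite ht hi st ltxx => /(_ isT).
by rewrite zE t0 cos0 /= mulr1 mul0r subr0.
Qed.

Lemma normc_add_Re_gt0 w :
  (complex.Im w = 0 -> 0 < complex.Re w) -> 0 < normc w + complex.Re w.
Proof.
case: w => x y /= h; have [y0|y0] := eqVneq y 0.
  by rewrite y0; have := h y0 => x0; rewrite ltr_wpDl ?sqrtr_ge0.
have : `|x| < Num.sqrt (x ^+ 2 + y ^+ 2).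
  rewrite -sqrtr_sqr ltr_sqrt ?ltrDl ?exprn_even_gt0 //.
  by rewrite ltr_wpDl ?sqr_ge0 // exprn_even_gt0.
have := ler_norm (- x); rewrite normrN; lra.
Qed.

Lemma Re_le_normc w : complex.Re w <= normc w.
Proof.
case: w => x y /=; apply: (le_trans (ler_norm x)).
by rewrite -sqrtr_sqr ler_sqrt ?addr_ge0 ?sqr_ge0 // lerDl sqr_ge0.
Qed.

(** The convex function [|p + q mu|] of the real variable [mu] is bounded on
    an interval by its values at the ends. *)
Lemma normc_affine_le p q (l1 lN mu : R) : l1 <= mu <= lN ->
  normc (p + q * mu%:C) <=
    Num.max (normc (p + q * l1%:C)) (normc (p + q * lN%:C)).
Proof.
move=> /andP[h1 hN]; set M := Num.max _ _.
have M1 : normc (p + q * l1%:C) <= M by rewrite le_max lexx.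
have MN : normc (p + q * lN%:C) <= M by rewrite le_max lexx orbT.
have [l1N|] := ltP l1 lN; last first.
  by move=> lN1; have -> : mu = l1 by apply/eqP; rewrite eq_le h1 (le_trans hN).
have d0 : 0 < lN - l1 by rewrite subr_gt0.
(* [mu] as a convex combination of [l1] and [lN], cleared of denominators. *)
have key : (lN - l1)%:C * (p + q * mu%:C) =
  (lN - mu)%:C * (p + q * l1%:C) + (mu - l1)%:C * (p + q * lN%:C).
  by rewrite !rmorphB /=; ring.
rewrite -(ler_pM2l d0) -{1}(gtr0_norm d0) -normc_real -normcM key.
apply: (le_trans (le_normcD _ _)); rewrite !normcM !normc_real.
rewrite !ger0_norm ?subr_ge0 //.
have -> : (lN - l1) * M = (lN - mu) * M + (mu - l1) * M by ring.
by rewrite lerD // ler_wpM2l ?subr_ge0.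
Qed.

Lemma two_point_lower_bound a b alpha :
  normc (b - a) <= (normc a + normc b) *
    Num.max (normc (1 - alpha * a)) (normc (1 - alpha * b)).
Proof.
have -> : b - a = b * (1 - alpha * a) - a * (1 - alpha * b) by ring.
apply: (le_trans (normc_sub _ _)); rewrite !normcM addrC mulrDl.
by rewrite lerD // ler_wpM2l ?normc_ge0 // le_max lexx ?orbT.
Qed.

(** The value of [alpha] that minimizes the larger of [|1 - alpha a|] and
    [|1 - alpha b|]: the point dividing the segment from [1 / a] to [1 / b] in
    the ratio of [1 / |a|] to [1 / |b|]. *)
Definition two_point_opt a b : R[i] :=
  ((normc a)%:C / a + (normc b)%:C / b) / (normc a + normc b)%:C.

Lemma two_point_opt_l a b : a != 0 -> b != 0 ->
  normc (1 - two_point_opt a b * a) = normc (b - a) / (normc a + normc b).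
Proof.
move=> a0 b0.
have nab : 0 < normc a + normc b by rewrite addr_gt0 ?normc_gt0.
have nab0 : (normc a)%:C + (normc b)%:C != 0 :> R[i].
  by rewrite -rmorphD /= -(rmorph0 (real_complex R)) (inj_eq (@complexI _)) gt_eqF.
have -> : 1 - two_point_opt a b * a =
   (normc b)%:C / b * (b - a) / (normc a + normc b)%:C.
  by rewrite /two_point_opt rmorphD /=; field; rewrite a0 b0 nab0.
rewrite !normcM !normcV !normc_real (gtr0_norm nab) ger0_norm ?normc_ge0 //.
by rewrite divff ?mul1r // gt_eqF ?normc_gt0.
Qed.

Lemma two_point_optC a b : two_point_opt a b = two_point_opt b a.
Proof. by rewrite /two_point_opt addrC (addrC (normc a)). Qed.

Lemma two_point_opt_r a b : a != 0 -> b != 0 ->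
  normc (1 - two_point_opt a b * b) = normc (b - a) / (normc a + normc b).
Proof.
move=> a0 b0; rewrite two_point_optC two_point_opt_l //.
by rewrite -normcN opprB (addrC (normc b)).
Qed.

Lemma normc_rect (x y : R) :
  normc (x%:C + y%:C * 'i%C) = Num.sqrt (x ^+ 2 + y ^+ 2).
Proof. by rewrite /=; simpc. Qed.

Lemma complex_half : 2^-1 = (2^-1 : R)%:C.
Proof. by rewrite fmorphV rmorph_nat. Qed.

Lemma bisector_equidistant a b (s : R) :
  let w := 2^-1 * (a + b) + s%:C * ('i%C * (b - a)) in
  normc (w - a) = normc (w - b).
Proof.
rewrite /=.
have -> : 2^-1 * (a + b) + s%:C * ('i%C * (b - a)) - a
        = (b - a) * (2^-1 + s%:C * 'i%C) by field.
have -> : 2^-1 * (a + b) + s%:C * ('i%C * (b - a)) - b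
        = (b - a) * (- 2^-1 + s%:C * 'i%C) by field.
by rewrite complex_half -rmorphN !normcM !normc_rect sqrrN.
Qed.

Lemma equidistant_bisector a b w : a != b -> normc (w - a) = normc (w - b) ->
  exists s : R, w = 2^-1 * (a + b) + s%:C * ('i%C * (b - a)).
Proof.
move=> ab.
have ba0 : b - a != 0 by rewrite subr_eq0 eq_sym.
(* In the coordinate [t] the bisector is the imaginary axis. *)
pose t := (w - 2^-1 * (a + b)) / (b - a).
have wE : w = 2^-1 * (a + b) + t * (b - a) by rewrite /t divfK // addrC subrK.
pose x := complex.Re t; pose y := complex.Im t.
have tE : t = x%:C + y%:C * 'i%C by rewrite [LHS]complexE (mulrC 'i%C).
rewrite wE tE.
have -> : 2^-1 * (a + b) + (x%:C + y%:C * 'i%C) * (b - a) - a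
        = (b - a) * (x%:C + 2^-1 + y%:C * 'i%C) by field.
have -> : 2^-1 * (a + b) + (x%:C + y%:C * 'i%C) * (b - a) - b
        = (b - a) * (x%:C - 2^-1 + y%:C * 'i%C) by field.
rewrite complex_half -rmorphD -rmorphB !normcM !normc_rect.
move=> /mulfI; rewrite gt_eqF ?normc_gt0 // => /(_ isT)/eqP.
rewrite eqr_sqrt ?addr_ge0 ?sqr_ge0 // => /eqP xh.
have x0 : x = 0.
  apply: (@mulIf _ 2); rewrite ?pnatr_eq0 // mul0r.
  have -> : x * 2 = ((x + 2^-1) ^+ 2 + y ^+ 2) - ((x - 2^-1) ^+ 2 + y ^+ 2).
    by field.
  by rewrite xh subrr.
by exists y; rewrite x0 add0r mulrA.
Qed.

End Plane.

(** * The operator norm of [p + q A] *)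

Section OperatorNorm.
Context {R : realType} {V : vectType R[i]}.
Variable dot : {dot V for (@Num.conj R[i])}.

Lemma dot_norm_ge0 u : 0 <= dot_norm dot u.
Proof. exact: sqrtr_ge0. Qed.

Lemma sqr_dot_norm u : (dot_norm dot u ^+ 2)%:C = dot u u.
Proof.
have d0 : 0 <= dot u u by exact: dnorm_ge0.
rewrite /dot_norm sqr_sqrtr ?RRe_real ?ger0_real //.
by move: d0; rewrite lecE => /andP[].
Qed.

Lemma dot_normZ c u : dot_norm dot (c *: u) = normc c * dot_norm dot u.
Proof.
apply/eqP; rewrite -(@eqrXn2 _ 2) ?mulr_ge0 ?normc_ge0 ?dot_norm_ge0 //.
apply/eqP/complexI; rewrite sqr_dot_norm exprMn dnormZ.
by rewrite -sqr_dot_norm -[`|c|]/((normc c)%:C) -rmorphXn -rmorphM.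
Qed.

Lemma dot_norm_gt0 u : u != 0 -> 0 < dot_norm dot u.
Proof.
move=> u0; rewrite lt_def dot_norm_ge0 andbT; apply: contraNneq u0 => n0.
by rewrite -(dnorm_eq0 dot) -sqr_dot_norm n0 expr0n.
Qed.

Lemma dot_norm_le M u v : 0 <= M -> dot v v <= M%:C ^+ 2 * dot u u ->
  dot_norm dot v <= M * dot_norm dot u.
Proof.
move=> M0; rewrite -!sqr_dot_norm -rmorphXn -rmorphM lecR -exprMn /=.
by rewrite ler_pXn2r // nnegrE ?mulr_ge0 // dot_norm_ge0.
Qed.

Lemma op_norm_ub (T : 'End(V)) M : 0 <= M ->
  (forall u, dot_norm dot (T u) <= M * dot_norm dot u) ->
  ubound [set dot_norm dot (T u) | u in [set u | dot_norm dot u <= 1]] M.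
Proof.
move=> M0 hM _ [u /= u1 <-]; apply: (le_trans (hM u)).
by rewrite -[leRHS]mulr1 ler_wpM2l.
Qed.

Lemma op_norm_le (T : 'End(V)) M : 0 <= M ->
  (forall u, dot_norm dot (T u) <= M * dot_norm dot u) -> op_norm dot T <= M.
Proof.
move=> M0 hM; apply: ge_sup (op_norm_ub _ _ M0 hM).
exists (dot_norm dot (T 0)), 0 => //=.
by rewrite /dot_norm linear0l sqrtr0.
Qed.

(** The bound [M] is needed because the operator norm is defined as a
    supremum, which dominates the set only when that set is bounded. *)
Lemma eigenvalue_le_op_norm (T : 'End(V)) M e kappa : 0 <= M ->
  (forall u, dot_norm dot (T u) <= M * dot_norm dot u) ->
  e != 0 -> T e = kappa *: e -> normc kappa <= op_norm dot T.
Proof.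
move=> M0 hM e0 Te; have ne := dot_norm_gt0 _ e0.
apply: ub_le_sup; first by exists M; exact: op_norm_ub.
exists ((dot_norm dot e)^-1%:C *: e).
  by rewrite /= dot_normZ normc_real ger0_norm ?invr_ge0 ?mulVf ?gt_eqF // ltW.
rewrite linearZ /= Te !dot_normZ mulrCA normc_real.
by rewrite ger0_norm ?invr_ge0 ?mulVf ?mulr1 ?gt_eqF // ltW.
Qed.

Lemma op_norm_affine_hermitian (A T : 'End(V)) (p q : R[i]) (l1 lN : R) :
  hermitian_op dot A ->
  is_min [set mu : R[i] | leigenvalue A mu] l1%:C ->
  is_max [set mu : R[i] | leigenvalue A mu] lN%:C ->
  (forall u, T u = p *: u + q *: A u) ->
  op_norm dot T = Num.max (normc (p + q * l1%:C)) (normc (p + q * lN%:C)).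
Proof.
move=> hA [ev1 lb1] [evN ubN] TE; set M := Num.max _ _.
have M0 : 0 <= M by rewrite le_max normc_ge0.
have hM u : dot_norm dot (T u) <= M * dot_norm dot u.
  apply: dot_norm_le => //; rewrite TE.
  apply: (hermitian_affine_bound dot A) => // mu evmu.
  have := lb1 mu evmu; rewrite lecE /= => /andP[/eqP imu l1mu].
  have := ubN mu evmu; rewrite lecE /= => /andP[_ muN].
  have -> : mu = (complex.Re mu)%:C by rewrite [LHS]complexE imu mulr0 addr0.
  by rewrite -[`|_|]/((normc _)%:C) lecR normc_affine_le // l1mu.
apply/eqP; rewrite eq_le op_norm_le // andTb ge_max.
suff h (l : R) : leigenvalue A l%:C -> normc (p + q * l%:C) <= op_norm dot T.
  by apply/andP; split; [exact: (h l1 ev1)|exact: (h lN evN)].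
move=> /leigenvalueP[e e0 Ae].
by apply: (eigenvalue_le_op_norm _ _ _ _ M0 hM e0); rewrite TE Ae scalerDl scalerA.
Qed.

Lemma richardson_op_norm (A : 'End(V)) (z alpha : R[i]) (l1 lN : R) :
  hermitian_op dot A ->
  is_min [set mu : R[i] | leigenvalue A mu] l1%:C ->
  is_max [set mu : R[i] | leigenvalue A mu] lN%:C ->
  op_norm dot (richardson_error_op (shifted_op z A) alpha) =
    Num.max (normc (1 - alpha * (z + l1%:C))) (normc (1 - alpha * (z + lN%:C))).
Proof.
move=> hA h1 hN.
rewrite (op_norm_affine_hermitian A _ (1 - alpha * z) (- alpha) l1 lN) //.
  by congr (Num.max (normc _) (normc _)); ring.
move=> u; rewrite /richardson_error_op /shifted_op !lfun_simp.
by rewrite scalerBl scale1r scaleNr scalerDr scalerA opprD addrA.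
Qed.

End OperatorNorm.

(** * The error reduction factor *)

Theorem theorem2p2 (R : realType) (z : R[i]) (lambda1 : R)
    (hz : exists theta : R, is_arg z theta /\ - pi < theta < pi)
    (hlambda1 : 0 < lambda1) :
  exists c Lambda0 : R, 0 < c /\
    forall (V : vectType R[i]) (dot : {dot V for (@Num.conj R[i])})
           (A : 'End(V)) (lambdaN : R),
      hermitian_op dot A ->
      posdef_op dot A ->
      is_min [set mu : R[i] | leigenvalue A mu] lambda1%:C ->
      is_max [set mu : R[i] | leigenvalue A mu] lambdaN%:C ->
      Lambda0 <= lambdaN ->
      let Az := shifted_op z A in
      let a : R[i] := z + lambda1%:C in
      let b : R[i] := z + lambdaN%:C in
      let cc : R[i] := 2^-1 * (a + b) in
      let dd : R[i] := 'i%C * (b - a) in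
      let adm : set R := [set s : R | cc + s%:C * dd != 0] in
      let Rs (s : R) : R := normc (1 - a / (cc + s%:C * dd)) ^+ 2 in
      (exists s : R, minimizes adm Rs s) /\
      forall s : R, minimizes adm Rs s ->
        let alphaz : R[i] := (cc + s%:C * dd)^-1 in
        let eps : R := error_reduction_factor dot Az in
        [/\ is_min (richardson_rates dot Az) eps,
            eps = normc (1 - alphaz * a)
          & normc (1 - alphaz * a) <= 1 - c * lambdaN^-1].
Proof.
have [theta [argz theta_pi]] := hz.
have reD (l : R) : complex.Re (z + l%:C) = complex.Re z + l by case: (z).
have imD (l : R) : complex.Im (z + l%:C) = complex.Im z.
  by case: (z) => x y /=; rewrite addr0.
have offaxis (l : R) : 0 < l ->
    0 < normc (z + l%:C) + complex.Re (z + l%:C).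
  move=> l0; apply: normc_add_Re_gt0; rewrite imD reD => im0.
  by rewrite addr_gt0 // (is_arg_Re_gt0 _ _ argz theta_pi im0).
have ne0 (l : R) : 0 < l -> z + l%:C != 0.
  by move=> /offaxis; apply: contraTneq => ->; rewrite normc_real normr0 addr0 ltxx.
pose c := (normc (z + lambda1%:C) + complex.Re (z + lambda1%:C)) / 2.
(* [lambda1 + 1] makes [a] and [b] distinct; the other bound gives
   [|a| + |b| <= 2 lambdaN]. *)
exists c, (Num.max (lambda1 + 1) (normc (z + lambda1%:C) + normc z)); split.
  by rewrite divr_gt0 ?offaxis.
move=> V dot A lambdaN hA _ h1 hN; rewrite ge_max => /andP[lN1 lNz].
move=> Az a b cc dd adm Rs.
rewrite -/a in c lNz *.
have lN0 : 0 < lambdaN by rewrite (lt_le_trans _ lN1) // addr_gt0.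
have l1N : lambda1 < lambdaN by rewrite (lt_le_trans _ lN1) // ltrDl.
have a0 : a != 0 by exact: ne0.
have b0 : b != 0 by exact: ne0.
have baE : b - a = (lambdaN - lambda1)%:C.
  by rewrite /b /a opprD addrACA subrr add0r rmorphB.
have ba : a != b.
  rewrite eq_sym -subr_eq0 baE -normc_gt0 normc_real.
  by rewrite normr_gt0 subr_eq0 gt_eqF.
have nab : 0 < normc a + normc b by rewrite addr_gt0 ?normc_gt0.
pose rho := normc (b - a) / (normc a + normc b).
have rho0 : 0 <= rho by rewrite divr_ge0 ?normc_ge0 // ltW.
have normba : normc (b - a) = lambdaN - lambda1.
  by rewrite baE normc_real gtr0_norm ?subr_gt0.
have rho_le : rho <= 1 - c * lambdaN^-1.
  have hb1 : normc b <= normc z + lambdaN.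
    by rewrite (le_trans (le_normcD _ _)) // normc_real gtr0_norm.
  have hb2 : complex.Re z + lambdaN <= normc b by rewrite -reD Re_le_normc.
  have ca : 2 * c = normc a + complex.Re a by rewrite /c; field.
  have ra : complex.Re a = complex.Re z + lambda1 by rewrite reD.
  have c0 : 0 < c by rewrite divr_gt0 ?offaxis.
  rewrite /rho normba ler_pdivrMr // mulrBl mul1r.
  have : c * lambdaN^-1 * (normc a + normc b) <= c * lambdaN^-1 * (2 * lambdaN).
    apply: ler_wpM2l; first by rewrite ltW // mulr_gt0 ?invr_gt0.
    by clear -hb1 lNz; lra.
  have -> : c * lambdaN^-1 * (2 * lambdaN) = 2 * c by field; rewrite gt_eqF.
  lra.
have rho1 : rho < 1.
  apply: (le_lt_trans rho_le); rewrite ltrBlDr ltrDl.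
  by rewrite mulr_gt0 ?invr_gt0 // divr_gt0 ?offaxis.
pose opt := two_point_opt a b.
have opta : normc (1 - opt * a) = rho by exact: two_point_opt_l.
have optb : normc (1 - opt * b) = rho by exact: two_point_opt_r.
have opt0 : opt != 0.
  apply: contraTneq rho1 => o0; rewrite -opta o0 mul0r subr0.
  by rewrite normc_real normr1 ltxx.
have lower alpha : rho <= Num.max (normc (1 - alpha * a)) (normc (1 - alpha * b)).
  by rewrite ler_pdivrMr // mulrC two_point_lower_bound.
have RsE s : Rs s = normc (1 - (cc + s%:C * dd)^-1 * a) ^+ 2.
  by rewrite /Rs mulrC.
have bis s : adm s -> normc (1 - (cc + s%:C * dd)^-1 * a)
    = normc (1 - (cc + s%:C * dd)^-1 * b).
  move=> w0; have := bisector_equidistant a b s; rewrite -/dd -/cc /=.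
  move: w0; rewrite /adm /=; set w := _ + _ => w0 e.
  have h x : 1 - w^-1 * x = w^-1 * (w - x) by rewrite mulrBr mulVf.
  by rewrite !h !normcM e.
have Rs_ge s : adm s -> rho ^+ 2 <= Rs s.
  move=> as_; have := lower (cc + s%:C * dd)^-1.
  by rewrite -bis // maxxx RsE => h; rewrite lerXn2r // nnegrE normc_ge0.
have [s0 s0E] : exists s, opt^-1 = cc + s%:C * dd.
  apply: equidistant_bisector => //.
  have h x : opt^-1 - x = opt^-1 * (1 - opt * x) by rewrite mulrBr mulr1 mulKf.
  by rewrite !h !normcM opta optb.
have adm0 : adm s0 by rewrite /adm /= -s0E invr_eq0.
have Rs0 : Rs s0 = rho ^+ 2 by rewrite RsE -s0E invrK opta.
split.
  exists s0; split=> //; split; first by exists s0.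
  by move=> _ [s as_ <-]; rewrite Rs0 Rs_ge.
move=> s [as_ [_ mins]] alphaz eps.
have Rss : normc (1 - alphaz * a) = rho.
  have : Rs s = rho ^+ 2.
    apply/eqP; rewrite eq_le Rs_ge // andbT -Rs0; apply: mins.
    by exists s0.
  by rewrite RsE => /eqP; rewrite eqrXn2 ?normc_ge0 // => /eqP.
have rate alpha := richardson_op_norm dot A z alpha _ _ hA h1 hN.
have minrho : is_min (richardson_rates dot Az) rho.
  split; first by exists opt => //; rewrite rate -/a -/b opta optb maxxx.
  by move=> _ [alpha _ <-]; rewrite rate.
have epsE : eps = rho.
  apply/eqP; rewrite eq_le; apply/andP; split.
    by apply: ge_inf; [exists rho; exact: minrho.2|exact: minrho.1].
  by apply: lb_le_inf; [exists rho; exact: minrho.1|exact: minrho.2].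
by rewrite epsE Rss.
Qed.
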